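(* Let $P$ be a set of $n$ points on a line $\ell$, let $\mathcal{I}$ be the set of intervals of $\ell$, let $H=H(P,\mathcal{I})$, and let $H'$ be the sub-hypergraph of $H^{\cup}$ (on the same vertex set $P$) consisting of all hyperedges of $H^{\cup}$ of size at least $3$. Then $\chi_{CF}(H')\ge\sqrt{n-1}$.
   Context: $H(P,\mathcal{I})$ is the hypergraph with vertex set $P$ and hyperedges $I\cap P$ for $I\in\mathcal{I}$. For a hypergraph $H=(V,\mathcal{E})$, $H^{\cup}=(V,\{e\cup f: e,f\in\mathcal{E}\})$. A conflict-free colouring of a hypergraph $(V,\mathcal{F})$ is a colouring $\varphi$ of $V$ such that every nonempty $h\in\mathcal{F}$ contains a vertex $x$ with $\varphi(y)\neq\varphi(x)$ for all $y\in h\setminus\{x\}$; $\chi_{CF}$ is the least number of colours of such a colouring. *)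

(* Defs.v *)
From mathcomp Require Import all_boot all_order all_algebra finmap.
From mathcomp Require Import boolp classical_sets set_interval reals.

Set Implicit Arguments.
Unset Strict Implicit.
Unset Printing Implicit Defensive.

Import Order.TTheory GRing.Theory Num.Theory.

(* A finite hypergraph is given by its set of hyperedges over a finite type; *)
(* the vertex set is the whole type, so isolated vertices are kept.          *)
Definition hypergraph (V : finType) := {set {set V}}.

(* H(P, F), whose vertex type is the finite type of the elements of P.       *)
Definition trace_hypergraph (T : choiceType) (P : {fset T})
    (F : set (set T)) : hypergraph P :=
  [set e : {set P} |
    `[< exists2 I : set T, F I & e = [set x : P | val x \in I]%SET >]]%SET.

Definition union_hypergraph (V : finType) (H : hypergraph V) : hypergraph V :=
  [set e :|: f | e in H, f in H]%SET.

Definition edges_of_size_ge (V : finType) (m : nat) (H : hypergraph V) :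
    hypergraph V :=
  [set e in H | m <= #|e|]%SET.

Definition conflict_free (V C : finType) (H : hypergraph V)
    (phi : {ffun V -> C}) : bool :=
  [forall h in H, (h != finset.set0) ==>
    [exists x in h, [forall y in (h :\ x)%SET, phi y != phi x]]].

Definition cf_colourable (V : finType) (H : hypergraph V) (k : nat) : bool :=
  [exists phi : {ffun V -> 'I_k}, conflict_free H phi].

Lemma cf_colourable_ex (V : finType) (H : hypergraph V) :
  exists k, cf_colourable H k.
Proof.
exists #|V|; apply/existsP; exists [ffun x => enum_rank x].
apply/forall_inP => h _; apply/implyP => /finset.set0Pn[x xh].
apply/exists_inP; exists x => //; apply/forall_inP => y.
by rewrite !inE !ffunE (inj_eq enum_rank_inj) => /andP[].
Qed.

Definition chi_CF (V : finType) (H : hypergraph V) : nat :=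
  ex_minn (cf_colourable_ex H).

Definition line_intervals (R : realType) : set (set R) :=
  [set [set` i] | i in [set: interval R]]%classic.

(* Main.v *)
(** Cover the points, in increasing order, by the [n - 1] pairs of neighbours;
    each pair is a hyperedge.  If there were more than [k ^ 2] of them, two
    distinct pairs [(a, b)] and [(c, d)] would have the same ordered pair of
    colours, so that in the union [{a, b, c, d}], which has at least three
    elements, every vertex shares its colour with another one: [a] with [c] and
    [b] with [d].  Ordered pairs of colours make this work even if [b = c]. *)
Require Import Defs.
From mathcomp Require Import all_boot all_order all_algebra finmap.
From mathcomp Require Import boolp classical_sets set_interval reals.

Set Implicit Arguments.
Unset Strict Implicit.
Unset Printing Implicit Defensive.

Import Order.TTheory GRing.Theory Num.Theory.
Local Open Scope ring_scope.

Lemma conflict_free_colours_neq (V C : finType) (H : hypergraph V)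
    (phi : {ffun V -> C}) (a b c d : V) :
  conflict_free H phi -> [set a; b] :|: [set c; d] \in H ->
  a != c -> b != d -> (phi a, phi b) != (phi c, phi d).
Proof.
move=> /forall_inP cf /cf /implyP + ac bd; apply: contraPneq => -[pac pbd].
move=> /(_ _)/exists_inP[|x xh /forall_inP uniq_x].
  by apply/finset.set0Pn; exists a; rewrite !inE eqxx.
(* The partner [y] of [x] comes from swapping [a] with [c] and [b] with [d]. *)
have [y yh pyx]: exists2 y, y \in ([set a; b] :|: [set c; d]) :\ x
                          & phi y = phi x.
  move: xh; rewrite !inE -!orbA => /or4P[]/eqP->;
    [exists c | exists d | exists a | exists b];
    by rewrite // !inE eqxx ?orbT ?andbT // eq_sym.
by have := uniq_x y yh; rewrite pyx eqxx.
Qed.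

(** The combinatorial half: geometry enters only through the neighbouring pairs being hyperedges, so
    [H] is arbitrary. *)
Lemma size_le_cf_colours (V : finType) (H : hypergraph V) (s : seq V) (x0 : V)
    (k : nat) :
  uniq s ->
  (forall i, (i.+1 < size s)%N -> [set nth x0 s i; nth x0 s i.+1] \in H) ->
  cf_colourable (edges_of_size_ge 3 (union_hypergraph H)) k ->
  ((size s).-1 <= k ^ 2)%N.
Proof.
move=> uniq_s sH /existsP[phi cf].
have ltS (i : 'I_(size s).-1) : (i.+1 < size s)%N.
  by have := ltn_ord i; case: (size s) i => [|m] [].
pose f (i : 'I_(size s).-1) := (phi (nth x0 s i), phi (nth x0 s i.+1)).
suff /leq_card: injective f by rewrite card_prod !card_ord mulnn.
have neq (i j : 'I_(size s).-1) : (i < j)%N -> f i != f j.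
  move=> ij; have [iS jS] := (ltS i, ltS j).
  have nthE p q : (p < size s)%N -> (q < size s)%N ->
      (nth x0 s p == nth x0 s q) = (p == q) by move=> *; rewrite nth_uniq.
  apply: (conflict_free_colours_neq cf); last 2 first.
  - by rewrite nthE 1?ltnW // neq_ltn ij.
  - by rewrite nthE // eqSS neq_ltn ij.
  rewrite inE; apply/andP; split; first by apply: imset2_f; apply: sH.
  (* These three positions differ even when [j = i.+1], which gives the required size 3. *)
  have: uniq [:: nth x0 s i; nth x0 s i.+1; nth x0 s j.+1].
    rewrite /= !inE !nthE ?(ltnW iS) // !negb_or !neq_ltn !ltnS ij leqnn.
    by rewrite (ltnW ij).
  move=> /card_uniqP /= <-; apply/subset_leq_card/fintype.subsetP => x.
  by rewrite !inE => /or3P[]->; rewrite ?orbT.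
move=> i j fij; apply/val_inj; have [||//] := ltngtP i j => /neq.
  by rewrite fij eqxx.
by rewrite fij eqxx.
Qed.

(** The closed interval between two consecutive points catches no third one, since [s] lists all of
    [P] in increasing order. *)
Lemma trace_neighbours (R : realType) (P : {fset R}) (s : seq P) (x0 : P)
    (i : nat) :
  sorted <%O (map val s) -> (forall x, x \in s) -> (i.+1 < size s)%N ->
  [set nth x0 s i; nth x0 s i.+1] \in trace_hypergraph P (@line_intervals R).
Proof.
move=> lt_s s_all iS; have iL := ltnW iS; rewrite inE; apply/asboolP.
pose a := val (nth x0 s i); pose b := val (nth x0 s i.+1).
exists [set` Interval (BLeft a) (BRight b)]%classic.
  by exists (Interval (BLeft a) (BRight b)).
apply/setP => x; rewrite !inE mem_setE in_itv /=.
have ltE p q : (p < size s)%N -> (q < size s)%N ->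
    (val (nth x0 s p) <= val (nth x0 s q)) = (p <= q)%N.
  move=> ps qs; rewrite -!(nth_map x0 (val x0)) //.
  by rewrite lt_sorted_leq_nth // ?inE ?size_map.
have /(nthP x0)[j js <-] := s_all x.
rewrite !ltE // !nth_uniq //; last 2 first.
- by apply: (@map_uniq _ _ val); apply: lt_sorted_uniq.
- by apply: (@map_uniq _ _ val); apply: lt_sorted_uniq.
(* Only positions are left: [i <= j <= i.+1] has to mean that [j] is [i] or [i.+1]. *)
rewrite (leq_eqVlt j) ltnS andb_orr -eqn_leq eq_sym orbC.
by case: (eqVneq j) => [->|]; rewrite ?leqnSn ?andbF.
Qed.

Theorem theorem5p3 (R : realType) (n : nat) (P : {fset R})
    (cardP : #|` P|%fset = n) :
  let H := trace_hypergraph P (@line_intervals R) in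
  let H' := edges_of_size_ge 3 (union_hypergraph H) in
  (Num.sqrt (n%:R - 1 : R) <= (chi_CF H')%:R : Prop).
Proof.
move=> H H'; rewrite /chi_CF; case: ex_minnP => k colk _.
(* Squaring moves the bound to naturals. At [n = 0] the real difference is [-1] and [n.-1] is [0];
   both are at most [k ^ 2]. *)
suff nk : (n.-1 <= k ^ 2)%N.
  rewrite -[leRHS]ger0_norm // -sqrtr_sqr ler_wsqrtr // -natrX lerBlDr.
  by rewrite natr1 ler_nat; case: n nk {cardP}.
pose s : seq P := sort (relpre val <=%O) (enum {: P}).
have size_s : size s = n by rewrite size_sort -cardE -cardfE.
(* The empty set is settled first, as it offers no default point for [nth]. *)
case: n cardP size_s => // n _ size_s.
have [x0 _] : exists x0, x0 \in s.
  by case: s size_s => // x t _; exists x; rewrite mem_head.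
rewrite -size_s; apply: (size_le_cf_colours (x0 := x0) _ _ colk).
  by rewrite sort_uniq enum_uniq.
move=> i; apply: trace_neighbours => [|x]; last by rewrite mem_sort mem_enum.
rewrite lt_sorted_uniq_le map_inj_uniq ?sort_uniq ?enum_uniq;
  last exact: val_inj.
by rewrite sorted_map sort_sorted // => x y; apply: le_total.
Qed.
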